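(* Let $A\subseteq\mathbb{R}_1^2$ be a path connected subset. Then the closure $\overline{L(A)}$ of the double hatching $L(A)$ in $\mathbb{R}_1^2$, with the metric induced from $\mathbb{R}_1^2$, is isometric to the tight span $T(A)$ of $A$, where $A$ carries the metric induced from $\mathbb{R}_1^2$.
   Context: The Manhattan plane is $\mathbb{R}_1^2=(\mathbb{R}^2,d_1)$ with $d_1((x_1,y_1),(x_2,y_2))=|x_1-x_2|+|y_1-y_2|$. Path connected sets are understood to be nonempty. Hatching: for $A\subseteq\mathbb{R}_1^2$ and $x,y\in\mathbb{R}$ let $A_x=\{(p_1,p_2)\in A : p_1=x\}$ and $A^y=\{(p_1,p_2)\in A : p_2=y\}$. For a subset $X$ of a horizontal or vertical line, $[X]$ denotes the minimal segment (possibly infinite or empty, not necessarily closed) containing $X$ and contained in the same line, i.e. the convex hull of $X$. Define $L_x(A)=\bigcup_{y\in\mathbb{R}}[A^y]$ and $L_y(A)=\bigcup_{x\in\mathbb{R}}[A_x]$. For path connected $A$ one has $L_x(L_y(A))=L_y(L_x(A))$, and the double hatching of $A$ is $L(A)=L_x(L_y(A))=L_y(L_x(A))$. Tight span: for a metric space $(X,d)$, $T(X)$ is the set of pointwise minimal functions among all functions $f:X\to\mathbb{R}^{\geq 0}$ satisfying $f(x)+f(y)\geq d(x,y)$ for all $x,y\in X$ (minimal means: if $g:X\to\mathbb{R}^{\ge 0}$ satisfies the same inequalities and $g\leq f$ pointwise, then $g=f$), with the supremum metric $d_\infty(f,g)=\sup_{x\in X}|f(x)-g(x)|$. *)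

(* Defs.v *)
From HB Require Import structures.
From mathcomp Require Import all_boot all_order all_algebra.
From mathcomp Require Import all_classical all_reals all_analysis.
From mathcomp Require Import lra.

Set Implicit Arguments.
Unset Strict Implicit.
Unset Printing Implicit Defensive.

Import Order.TTheory GRing.Theory Num.Theory.
Import numFieldNormedType.Exports.

Local Open Scope classical_set_scope.
Local Open Scope ring_scope.

(* A fresh name for [R * R]: it does not inherit the library's sup-metric
   structure on pairs, so that its topology (closures, continuity of paths)
   is the one generated by the l1-distance. *)
Definition manhattan (R : realType) : Type := (R * R)%type.

Section Manhattan.
Context {R : realType}.
Implicit Types p q r : manhattan R.

Definition d1 p q : R := `|p.1 - q.1| + `|p.2 - q.2|.

Lemma d1xx p : d1 p p = 0.
Proof. by rewrite /d1 !subrr normr0 addr0. Qed.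

Lemma d1_positivity p q : d1 p q = 0 -> p = q.
Proof.
move=> /eqP; rewrite paddr_eq0 ?normr_ge0// !normr_eq0 !subr_eq0.
by case: p q => [a b] [c d] /= /andP[/eqP -> /eqP ->].
Qed.

Lemma d1_sym p q : d1 p q = d1 q p.
Proof. by rewrite /d1 distrC (distrC p.2). Qed.

Lemma d1_triangle q p r : d1 p r <= d1 p q + d1 q r.
Proof. by rewrite /d1 addrACA lerD// ler_distD. Qed.

End Manhattan.

HB.instance Definition _ (R : realType) :=
  Choice.copy (manhattan R) (R * R)%type.
HB.instance Definition _ (R : realType) := @isMetric.Build R (manhattan R)
  d1 d1xx d1_positivity d1_sym d1_triangle.

Section SubMetric.
Context {R : realType} {X : metricType R} (A : set X).
Implicit Types x y : set_type A.

Definition sub_mdist x y : R := mdist (\val x) (\val y).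

Let sub_mdist_ge0 x y : 0 <= sub_mdist x y.
Proof. exact: mdist_ge0. Qed.

Let sub_mdist_positivity x y : sub_mdist x y = 0 -> x = y.
Proof. by move=> /mdist_positivity /val_inj. Qed.

Let sub_ballE x (d : R) : ball x d = [set y | sub_mdist x y < d].
Proof.
have -> : ball x d = [set y | ball (\val x) d (\val y)] by [].
by apply/seteqP; split=> y; rewrite /= ballEmdist.
Qed.

HB.instance Definition _ := PseudoMetric_isMetric.Build R (set_type A)
  sub_mdist_ge0 sub_mdist_positivity sub_ballE.

End SubMetric.

Definition path_connected (R : realType) (T : topologicalType) (A : set T) :=
  A !=set0 /\
  forall x y : T, A x -> A y ->
    exists f : R -> T, [/\ {within `[0, 1], continuous f},
      f 0 = x, f 1 = y & f @` `[0, 1] `<=` A].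

Section Hatching.
Context {R : realType}.
Implicit Types (A S : set (manhattan R)) (x y : R).

Definition vslice A x : set (manhattan R) := A `&` [set p | p.1 = x].
Definition hslice A y : set (manhattan R) := A `&` [set p | p.2 = y].

(* Segments are possibly empty, unbounded, or not closed. *)
Definition vsegment x : set (set (manhattan R)) :=
  [set S | exists2 I : set R, is_interval I & S = [set (x, t) | t in I]].
Definition hsegment y : set (set (manhattan R)) :=
  [set S | exists2 I : set R, is_interval I & S = [set (t, y) | t in I]].

(* [Lx] fills horizontal lines and [Ly] vertical ones. *)
Definition Lx A : set (manhattan R) :=
  \bigcup_y smallest (hsegment y) (hslice A y).
Definition Ly A : set (manhattan R) :=
  \bigcup_x smallest (vsegment x) (vslice A x).

(* For path connected [A] this is also [Ly (Lx A)]. *)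
Definition double_hatching A : set (manhattan R) := Lx (Ly A).

End Hatching.

Section TightSpan.
Context {R : realType} {X : metricType R}.
Implicit Types (f g : X -> R) (x y : X).

Definition dominates_dist f :=
  (forall x, 0 <= f x) /\ (forall x y, mdist x y <= f x + f y).

Definition minimal_dominating f :=
  dominates_dist f /\
  forall g, dominates_dist g -> (forall x, g x <= f x) -> g = f.

Lemma minimal_dominating_lip f x y :
  minimal_dominating f -> f x <= f y + mdist x y.
Proof.
move=> [[f0 fd] fmin]; rewrite leNgt; apply/negP => lt_f.
pose g z := if pselect (z = x) then f y + mdist x y else f z.
have gx : g x = f y + mdist x y by rewrite /g; case: pselect.
have gN z : z <> x -> g z = f z by rewrite /g; case: pselect.
have key z : mdist x z <= f y + mdist x y + f z.
  by have := metric_triangle x y z; have := fd y z; lra.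
suff gf : g = f by move: lt_f; rewrite -gx gf ltxx.
apply: fmin; last first.
  move=> z; have [->|zx] := pselect (z = x); first by rewrite gx ltW.
  by rewrite gN.
split=> [z|z t].
  have [->|zx] := pselect (z = x); last by rewrite gN.
  by rewrite gx addr_ge0// mdist_ge0.
have [->|zx] := pselect (z = x); have [->|tx] := pselect (t = x).
- by rewrite mdistxx gx addr_ge0// addr_ge0// mdist_ge0.
- by rewrite gx gN.
- by rewrite metric_sym addrC gx gN.
- by rewrite !gN.
Qed.

End TightSpan.

Record tight_span (R : realType) (X : metricType R) := TightSpan {
  ts_fun :> X -> R;
  ts_funP : minimal_dominating ts_fun }.

HB.instance Definition _ (R : realType) (X : metricType R) :=
  gen_eqMixin (tight_span X).
HB.instance Definition _ (R : realType) (X : metricType R) :=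
  gen_choiceMixin (tight_span X).

Section TightSpanMetric.
Context {R : realType} {X : metricType R}.
Implicit Types f g h : tight_span X.

(* The set is bounded by [ts_has_ubound], and it is empty only if [X] is, in
   which case [sup] returns 0; so this is always the true supremum. *)
Definition dinfty f g : R := sup [set `|f x - g x| | x in [set: X]].

Lemma ts_has_ubound f g : has_ubound [set `|f x - g x| | x in [set: X]].
Proof.
have [[x0 _]|/nonemptyPn X0] := pselect ([set: X] !=set0); last first.
  by exists 0 => _ [x _ <-]; have : [set: X] x by []; rewrite X0.
exists (f x0 + g x0) => _ [x _ <-].
have [[_ fd] [_ gd]] := ((ts_funP f).1, (ts_funP g).1).
have fl := minimal_dominating_lip x x0 (ts_funP f).
have gl := minimal_dominating_lip x x0 (ts_funP g).
have := fd x x0; have := gd x x0; rewrite ler_norml => ? ?.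
by apply/andP; split; lra.
Qed.

Lemma le_dinfty f g x : `|f x - g x| <= dinfty f g.
Proof. by apply: ub_le_sup; [exact: ts_has_ubound | exists x]. Qed.

Lemma dinfty_le f g (c : R) :
  0 <= c -> (forall x, `|f x - g x| <= c) -> dinfty f g <= c.
Proof.
move=> c0 fgc; have [[x0 _]|/nonemptyPn X0] := pselect ([set: X] !=set0).
  by apply: ge_sup => [|_ [x _ <-]]//; exists `|f x0 - g x0|, x0.
by rewrite /dinfty X0 image_set0 sup0.
Qed.

Lemma dinfty_ge0 f g : 0 <= dinfty f g.
Proof.
have [[x0 _]|/nonemptyPn X0] := pselect ([set: X] !=set0).
  exact: le_trans (le_dinfty f g x0).
by rewrite /dinfty X0 image_set0 sup0.
Qed.

Lemma tight_span_eq f g : f =1 g -> f = g.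
Proof.
case: f g => [f fP] [g gP] /= /funext fg; rewrite fg in fP *.
by rewrite (Prop_irrelevance fP gP).
Qed.

Lemma dinftyxx f : dinfty f f = 0.
Proof.
apply/eqP; rewrite eq_le dinfty_ge0 andbT.
by apply: dinfty_le => // x; rewrite subrr normr0.
Qed.

Lemma dinfty_positivity f g : dinfty f g = 0 -> f = g.
Proof.
move=> fg0; apply: tight_span_eq => x; apply/eqP.
by rewrite -subr_eq0 -normr_le0 -fg0 le_dinfty.
Qed.

Lemma dinfty_sym f g : dinfty f g = dinfty g f.
Proof. by congr sup; apply: eq_imagel => x _; rewrite distrC. Qed.

Lemma dinfty_triangle g f h : dinfty f h <= dinfty f g + dinfty g h.
Proof.
apply: dinfty_le => [|x]; first by rewrite addr_ge0 ?dinfty_ge0.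
by rewrite (le_trans (ler_distD (g x) _ _))// lerD ?le_dinfty.
Qed.

HB.instance Definition _ := @isMetric.Build R (tight_span X)
  dinfty dinftyxx dinfty_positivity dinfty_sym dinfty_triangle.

End TightSpanMetric.

Definition isometric (R : realType) (X Y : metricType R) :=
  exists2 phi : X -> Y, bijective phi &
    forall x y, mdist (phi x) (phi y) = mdist x y.

(* Main.v *)
Require Import Defs.
From mathcomp Require Import all_boot all_order all_algebra.
From mathcomp Require Import all_classical all_reals all_analysis.
From mathcomp Require Import lra.

(* The isometry sends p to the function d1(p, -) on A.
   For path connected A, the double hatching L(A) is the set of points all of
   whose four closed quadrants meet A.  If p, q lie in L(A), some a in A has q
   between p and a, so d1(p, -) and d1(q, -) differ by exactly d1(p, q) at a;
   likewise each x in A has p between x and some a in A, which makes d1(p, -)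
   minimal.  Both facts pass to the closure.  Conversely, closed l1-balls in the plane have the
   Helly property, so every f in T(A) dominates, hence equals, some d1(p, -);
   if a quadrant at such a p misses A, minimality of d1(p, -) gives points of A
   almost opposite to each other around p, from which one reads off points of
   L(A) arbitrarily close to p. *)

Set Implicit Arguments.
Unset Strict Implicit.
Unset Printing Implicit Defensive.

Import Order.TTheory GRing.Theory Num.Theory.
Import numFieldNormedType.Exports.

Local Open Scope classical_set_scope.
Local Open Scope ring_scope.

(** * Minimal functions and approximate tightness *)

Section Extremal.
Context {R : realType} {X : metricType R}.
Implicit Types (f : X -> R) (x y : X).

(** If every inequality at [x] had slack more than [e], lowering [f] at [x] alone would contradict
    minimality. *)
Lemma minimal_dominating_tight f : minimal_dominating f ->
  forall x e, 0 < e -> exists y, f x + f y <= mdist x y + e.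
Proof.
move=> [[f0 fd] fmin] x e e0; apply: contrapT => /forallNP notight.
have lt_f y : mdist x y + e < f x + f y.
  by rewrite ltNge; apply/negP; exact: notight.
(* Truncation keeps [g] nonnegative. It still lowers [f x] strictly, since [lt_f x] forces
   [f x > 0]. *)
pose g z := if pselect (z = x) then Num.max 0 (f x - e) else f z.
have gx : g x = Num.max 0 (f x - e) by rewrite /g; case: pselect.
have gN z : z <> x -> g z = f z by rewrite /g; case: pselect.
have gx0 : 0 <= g x by rewrite gx le_max lexx.
have gxe : f x - e <= g x by rewrite gx le_max lexx orbT.
suff gf : g = f.
  have := lt_f x; have := f0 x; rewrite mdistxx.
  by have := gx; rewrite gf; case: (lerP 0 (f x - e)) => ? ? ? ?; lra.
apply: fmin => [|z]; last first.
  have [->|zx] := pselect (z = x); last by rewrite gN.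
  by rewrite gx ge_max f0 gerBl ltW.
split=> [z|z t].
  by have [->|zx] := pselect (z = x); last rewrite gN.
have [->|zx] := pselect (z = x); have [->|tx] := pselect (t = x).
- by rewrite mdistxx addr_ge0.
- by rewrite (gN t)//; have := lt_f t; lra.
- by rewrite (gN z)// metric_sym; have := lt_f z; lra.
- by rewrite !gN.
Qed.

(** For [g] dominating and below [f], a partner [y] of [x] gives [g x >= d(x,y) - g y >= d(x,y) - f
    y >= f x - e]. *)
Lemma tight_minimal_dominating f : dominates_dist f ->
  (forall x e, 0 < e -> exists y, f x + f y <= mdist x y + e) ->
  minimal_dominating f.
Proof.
move=> fd ftight; split=> // g [_ gd] gf; apply/funext => x.
apply/eqP; rewrite eq_le gf/=; apply/ler_addgt0Pr => e e0.
by have [y] := ftight x e e0; have := gd x y; have := gf y; lra.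
Qed.

End Extremal.

(** * Quadrants and the intermediate value property *)

Section Plane.
Context {R : realType}.
Implicit Types (A : set (manhattan R)) (p q a b c x y z : manhattan R).

(* [enclosed A q] says that every closed quadrant at [q] meets [A], stated
   without coordinates so that it is visibly invariant under isometries. *)
Definition enclosed A : set (manhattan R) :=
  [set q | forall c, exists2 a, A a & d1 c a = d1 c q + d1 q a].

(** Approximate tightness of the function d1(p, -) on [A]. *)
Definition tight_at A p := forall x (e : R), A x -> 0 < e ->
  exists2 y, A y & d1 p x + d1 p y <= d1 x y + e.

(** The form in which connectedness of [A] enters below; it passes directly through isometries of
    the plane. *)
Definition lipschitz_ivt A := forall g : manhattan R -> R,
  (forall p q, `|g p - g q| <= d1 p q) ->
  forall x y, A x -> A y -> g x <= 0 -> 0 <= g y -> exists2 z, A z & g z = 0.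

Lemma d1_ge0 p q : 0 <= d1 p q.
Proof. by rewrite /d1 addr_ge0. Qed.

Lemma path_connected_ivt A : path_connected R A -> lipschitz_ivt A.
Proof.
move=> [_ Apc] g glip x y Ax Ay gx gy.
have [f [fcont f0 f1 fA]] := Apc x y Ax Ay.
have gcont : continuous g.
  move=> p; have pF : Filter (nbhs p) by exact: nbhs_filter.
  apply/cvgrPdist_lt => e e0; apply: filterS (nbhsx_ballx p e e0) => q.
  by rewrite ballEmdist => /(le_lt_trans (glip p q)).
have gfcont : {within `[0, 1], continuous (g \o f)}.
  by move=> t; exact: cvg_comp (fcont t) (gcont (f t)).
have [||t t01 gft] := @IVT R (g \o f) 0 1 0 _ gfcont; first exact: ler01.
  by rewrite /= f0 f1 ge_min gx le_max gy orbT.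
by exists (f t) => //; apply: fA; exists t.
Qed.

Lemma enclosed_sub A : A `<=` enclosed A.
Proof. by move=> a Aa c; exists a => //; rewrite d1xx addr0. Qed.

(** For given [c], a point [a] in the quadrant opposite to [c] has [q] between [c] and [a] in both
    coordinates, so the distances add up. *)
Lemma enclosed_quadrants A q :
  (exists2 a, A a & q.1 <= a.1 /\ q.2 <= a.2) ->
  (exists2 a, A a & q.1 <= a.1 /\ a.2 <= q.2) ->
  (exists2 a, A a & a.1 <= q.1 /\ q.2 <= a.2) ->
  (exists2 a, A a & a.1 <= q.1 /\ a.2 <= q.2) ->
  enclosed A q.
Proof.
have btw_le (u v w : R) : u <= v -> v <= w -> `|u - w| = `|u - v| + `|v - w|.
  by move=> ? ?; rewrite !ler0_norm; lra.
have btw_ge (u v w : R) : v <= u -> w <= v -> `|u - w| = `|u - v| + `|v - w|.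
  by move=> ? ?; rewrite !ger0_norm; lra.
move=> [a1 A1 [? ?]] [a2 A2 [? ?]] [a3 A3 [? ?]] [a4 A4 [? ?]] c.
case: (leP c.1 q.1) => [|/ltW] ?; case: (leP c.2 q.2) => [|/ltW] ?;
  [exists a1|exists a2|exists a3|exists a4] => //; rewrite /d1 addrACA;
  by congr (_ + _); ((by apply: btw_le) || (by apply: btw_ge)).
Qed.

(** The signs [s] and [t] select a quadrant; testing [enclosed] from a point diagonally opposite to
    it yields [a]. *)
Lemma enclosed_quadrant A q (s t : R) : `|s| = 1 -> `|t| = 1 ->
  enclosed A q -> exists2 a, A a & 0 <= s * (a.1 - q.1) /\ 0 <= t * (a.2 - q.2).
Proof.
move=> s1 t1 Aq; have [a Aa H] := Aq (q.1 - s, q.2 - t); exists a => //.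
rewrite /d1/= in H.
have H1 := ler_distD q.1 (q.1 - s) a.1.
have H2 := ler_distD q.2 (q.2 - t) a.2.
have E1 : q.1 - s - q.1 = - s by lra.
have E2 : q.2 - t - q.2 = - t by lra.
rewrite E1 normrN s1 in H1; rewrite E2 normrN t1 in H2.
rewrite E1 E2 !normrN s1 t1 in H.
(* Equality in the sum forces equality in both coordinate triangle inequalities. *)
have D1 : `|q.1 - s - a.1| = 1 + `|q.1 - a.1| by lra.
have D2 : `|q.2 - t - a.2| = 1 + `|q.2 - a.2| by lra.
have key (r u v : R) : `|r| = 1 -> `|u - r - v| = 1 + `|u - v| ->
    0 <= r * (v - u).
  move=> /eqP; rewrite eqr_norml ler01 andbT => /orP[]/eqP->;
  by case: (ger0P (u - _ - v)); case: (ger0P (u - v)) => *; lra.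
by split; [exact: key s1 D1|exact: key t1 D2].
Qed.

(** * The double hatching as the set of enclosed points *)

Lemma smallest_hsegment A p :
  smallest (hsegment p.2) (hslice A p.2) p <->
  (exists2 a, A a & a.2 = p.2 /\ a.1 <= p.1) /\
  (exists2 a, A a & a.2 = p.2 /\ p.1 <= a.1).
Proof.
split=> [|[[a Aa [a2 ap]] [b Ab [b2 pb]]] S [[I Iitv ->] AI]].
  (* An explicit interval containing the slice: the abscissae with points of the slice weakly on
     both sides. *)
  pose I := [set t | (exists2 a, A a & a.2 = p.2 /\ a.1 <= t) /\
                     (exists2 a, A a & a.2 = p.2 /\ t <= a.1)].
  move=> /(_ [set (t, p.2) | t in I]) [].
  - split; last first.
      move=> a [Aa /= a2].
      by exists a.1; [split; exists a|rewrite -a2; case: a {Aa a2}].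
    exists I => // u w [[a Aa [a2 au]] _] [_ [b Ab [b2 wb]]] v /andP[uv vw].
    split; [exists a => //|exists b => //]; split => //.
      exact: le_trans uv.
    exact: le_trans wb.
  - by move=> t tI <-.
have [u Iu ua] : [set (t, p.2) | t in I] a by exact: AI.
have [v Iv vb] : [set (t, p.2) | t in I] b by exact: AI.
exists p.1; last by case: (p).
by apply: (Iitv u v) => //; rewrite -ua -vb in ap pb; rewrite ap pb.
Qed.

Lemma smallest_vsegment A p :
  smallest (vsegment p.1) (vslice A p.1) p <->
  (exists2 a, A a & a.1 = p.1 /\ a.2 <= p.2) /\
  (exists2 a, A a & a.1 = p.1 /\ p.2 <= a.2).
Proof.
split=> [|[[a Aa [a2 ap]] [b Ab [b2 pb]]] S [[I Iitv ->] AI]].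
  pose I := [set t | (exists2 a, A a & a.1 = p.1 /\ a.2 <= t) /\
                     (exists2 a, A a & a.1 = p.1 /\ t <= a.2)].
  move=> /(_ [set (p.1, t) | t in I]) [].
  - split; last first.
      move=> a [Aa /= a2].
      by exists a.2; [split; exists a|rewrite -a2; case: a {Aa a2}].
    exists I => // u w [[a Aa [a2 au]] _] [_ [b Ab [b2 wb]]] v /andP[uv vw].
    split; [exists a => //|exists b => //]; split => //.
      exact: le_trans uv.
    exact: le_trans wb.
  - by move=> t tI <-.
have [u Iu ua] : [set (p.1, t) | t in I] a by exact: AI.
have [v Iv vb] : [set (p.1, t) | t in I] b by exact: AI.
exists p.2; last by case: (p).
by apply: (Iitv u v) => //; rewrite -ua -vb in ap pb; rewrite ap pb.
Qed.

Lemma LxP A p : Lx A p <->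
  (exists2 a, A a & a.2 = p.2 /\ a.1 <= p.1) /\
  (exists2 a, A a & a.2 = p.2 /\ p.1 <= a.1).
Proof.
rewrite -smallest_hsegment; split=> [[y _ Ap]|]; last by exists p.2.
suff -> : p.2 = y by [].
(* The full line at height [y] is a segment containing the slice, so [p] lies on it. *)
have [] // := Ap [set (t, y) | t in setT]; last by move=> t _ <-.
split; first by exists setT.
by move=> a [_ /= <-]; exists a.1 => //; case: a.
Qed.

Lemma LyP A p : Ly A p <->
  (exists2 a, A a & a.1 = p.1 /\ a.2 <= p.2) /\
  (exists2 a, A a & a.1 = p.1 /\ p.2 <= a.2).
Proof.
rewrite -smallest_vsegment; split=> [[x _ Ap]|]; last by exists p.1.
suff -> : p.1 = x by [].
have [] // := Ap [set (x, t) | t in setT]; last by move=> t _ <-.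
split; first by exists setT.
by move=> a [_ /= <-]; exists a.2 => //; case: a.
Qed.

(** Vertical filling supplies two points of [A] on each side of [p], one weakly above and one weakly
    below: one per quadrant. *)
Lemma double_hatching_sub_enclosed A : double_hatching A `<=` enclosed A.
Proof.
move=> p /LxP[[b /LyP[[b1 B1 [e1 l1]] [b2 B2 [e2 l2]]] [eb lb]]
  [c /LyP[[c1 C1 [e3 l3]] [c2 C2 [e4 l4]]] [ec lc]]].
by apply: enclosed_quadrants; [exists c2|exists c1|exists b2|exists b1];
  rewrite // ?e1 ?e2 ?e3 ?e4 -?eb // -?ec // eb -?ec.
Qed.

(** [A] must cross the boundary of the quadrant [(s, t)] at [p], since it meets both this quadrant
    and [(s, -t)]. The function [g] vanishes exactly on that boundary. *)
Lemma ivt_corner A p (s t : R) : lipschitz_ivt A -> `|s| = 1 -> `|t| = 1 ->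
  enclosed A p -> exists2 z, A z &
    z.1 = p.1 /\ 0 <= t * (z.2 - p.2) \/ z.2 = p.2 /\ 0 <= s * (z.1 - p.1).
Proof.
move=> Aivt s1 t1 Ap.
have [x Ax [x1 x2]] := enclosed_quadrant s1 t1 Ap.
have [y Ay [y1 y2]] : exists2 a, A a &
    0 <= s * (a.1 - p.1) /\ 0 <= - t * (a.2 - p.2).
  by apply: enclosed_quadrant; rewrite ?normrN.
pose g z := Num.min (s * (z.1 - p.1)) (t * (z.2 - p.2)).
have [|||z Az] := Aivt g _ y x Ay Ax.
- move=> a b.
  have ha : `|s * (a.1 - p.1) - s * (b.1 - p.1)| = `|a.1 - b.1|.
    by rewrite -mulrBr normrM s1 mul1r; congr `|_|; lra.
  have hb : `|t * (a.2 - p.2) - t * (b.2 - p.2)| = `|a.2 - b.2|.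
    by rewrite -mulrBr normrM t1 mul1r; congr `|_|; lra.
  rewrite /d1 -ha -hb /g {g ha hb}.
  move: (s * (a.1 - _)) (s * (b.1 - _)) (t * (a.2 - _)) (t * (b.2 - _)).
  move=> u u' v v'.
  have := ler_norm (u - u'); have := ler_norm (v - v').
  have := ler_norm (u' - u); have := ler_norm (v' - v).
  rewrite (distrC u') (distrC v') ler_norml.
  by case: (leP u v) => ?; case: (leP u' v') => ? *; apply/andP; split; lra.
- by rewrite /g ge_min; apply/orP; right; lra.
- by rewrite /g le_min x1.
have s0 : s != 0 by rewrite -normr_eq0 s1 oner_eq0.
have t0 : t != 0 by rewrite -normr_eq0 t1 oner_eq0.
rewrite /g; case: leP => h z0; exists z => //; [left|right]; split.
- by move/eqP: z0; rewrite mulf_eq0 (negbTE s0) subr_eq0 => /eqP.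
- by rewrite z0 in h.
- by move/eqP: z0; rewrite mulf_eq0 (negbTE t0) subr_eq0 => /eqP.
- by rewrite z0 in h; exact: ltW.
Qed.

Lemma enclosed_sub_double_hatching A : lipschitz_ivt A ->
  enclosed A `<=` double_hatching A.
Proof.
move=> Aivt p Ap.
have AL : A `<=` Ly A by move=> a Aa; apply/LyP; split; exists a.
have n1 : `|1 : R| = 1 by rewrite normr1.
have nN1 : `|-1 : R| = 1 by rewrite normrN1.
(* The boundaries of the quadrants [(s, 1)] and [(s, -1)] share a horizontal ray. Either [A] meets
   that ray, or it meets both vertical rays and [p] itself lies in [Ly A]. *)
have side (s : R) : `|s| = 1 ->
    exists2 a, Ly A a & a.2 = p.2 /\ 0 <= s * (a.1 - p.1).
  move=> s1; have [z Az [[z1 z2]|[z1 z2]]] := ivt_corner Aivt s1 n1 Ap; last first.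
    by exists z => //; exact: AL.
  have [w Aw [[w1 w2]|[w1 w2]]] := ivt_corner Aivt s1 nN1 Ap; last first.
    by exists w => //; exact: AL.
  exists p; last by rewrite subrr mulr0.
  by apply/LyP; split; [exists w|exists z] => //; split=> //; lra.
have [a La [a2 a1]] := side _ nN1; have [b Lb [b2 b1]] := side _ n1.
by apply/LxP; split; [exists a|exists b] => //; split => //; lra.
Qed.

(** * Limits of enclosed points and the closure of the hatching *)

Definition near_enclosed A p :=
  forall e : R, 0 < e -> exists2 q, enclosed A q & d1 p q <= e.

Lemma near_enclosed_closure A p : lipschitz_ivt A ->
  near_enclosed A p -> closure (double_hatching A) p.
Proof.
move=> Aivt nAp B /nbhs_ballP[e /= e0 eB].
have [|q Aq pq] := nAp (e / 2); first by rewrite divr_gt0.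
exists q; split; first exact: enclosed_sub_double_hatching.
apply: eB; rewrite ballEmdist /=; apply: le_lt_trans pq _.
by rewrite ltr_pdivrMr ?ltr_pMr // ltr1n.
Qed.

Lemma closure_near_enclosed A p :
  closure (double_hatching A) p -> near_enclosed A p.
Proof.
move=> Ap e e0; have [q [Aq pq]] := Ap _ (nbhsx_ballx p e e0).
exists q; first exact: double_hatching_sub_enclosed.
by move: pq; rewrite ballEmdist => /ltW.
Qed.

(** * Invariance under isometric involutions fixing [p] *)

Section Transport.
Variables (sigma : manhattan R -> manhattan R).
Variables (A : set (manhattan R)) (p : manhattan R).
Hypotheses (sigmaK : involutive sigma) (sigma_p : sigma p = p).
Hypothesis sigma_d1 : forall x y, d1 (sigma x) (sigma y) = d1 x y.

Let sd x y : d1 (sigma x) y = d1 x (sigma y).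
Proof. by rewrite -sigma_d1 sigmaK. Qed.

Lemma transport_ivt : lipschitz_ivt A -> lipschitz_ivt (sigma @^-1` A).
Proof.
move=> Aivt g glip x y Ax Ay gx gy.
have [|||z Az gz] := Aivt (g \o sigma) _ _ _ Ax Ay; rewrite /= ?sigmaK //.
  by move=> a b; rewrite -sigma_d1; exact: glip.
by exists (sigma z); rewrite /= ?sigmaK.
Qed.

Lemma transport_tight : tight_at A p -> tight_at (sigma @^-1` A) p.
Proof.
move=> At x e Ax e0; have [y Ay] := At _ _ Ax e0; rewrite sd.
rewrite -{1 2}sigma_p sigma_d1 sd.
by exists (sigma y); rewrite /= ?sigmaK.
Qed.

Lemma transport_near_enclosed :
  near_enclosed (sigma @^-1` A) p -> near_enclosed A p.
Proof.
move=> nA e e0; have [q Aq pq] := nA e e0.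
exists (sigma q); last by rewrite -sd sigma_p.
move=> c; have [a Aa H] := Aq (sigma c); exists (sigma a) => //.
by rewrite -sd H sd sigma_d1.
Qed.

End Transport.

(** * Tightness in coordinates, and reflections about a point *)

(** The triangle defects of the two coordinates are nonnegative with sum at most [e], so each is at
    most [e]; then [x] and [y] cannot both be more than [e] away on the same side. *)
Lemma tight_coord p x y (e : R) : d1 p x + d1 p y <= d1 x y + e ->
  [/\ x.1 < p.1 - e -> p.1 - e <= y.1, p.1 + e < x.1 -> y.1 <= p.1 + e,
      x.2 < p.2 - e -> p.2 - e <= y.2 & p.2 + e < x.2 -> y.2 <= p.2 + e].
Proof.
rewrite /d1 => H.
have T1 := ler_distD p.1 x.1 y.1; have T2 := ler_distD p.2 x.2 y.2.
rewrite (distrC x.1 p.1) in T1; rewrite (distrC x.2 p.2) in T2.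
have H1 : `|p.1 - x.1| + `|p.1 - y.1| <= `|x.1 - y.1| + e by lra.
have H2 : `|p.2 - x.2| + `|p.2 - y.2| <= `|x.2 - y.2| + e by lra.
have lo (u v w : R) : `|u - v| + `|u - w| <= `|v - w| + e ->
    v < u - e -> u - e <= w.
  by case: (ger0P (u - v)); case: (ger0P (u - w)); case: (ger0P (v - w)) => *; lra.
have hi (u v w : R) : `|u - v| + `|u - w| <= `|v - w| + e ->
    u + e < v -> w <= u + e.
  by case: (ger0P (u - v)); case: (ger0P (u - w)); case: (ger0P (v - w)) => *; lra.
by split; [exact: lo|exact: hi|exact: lo|exact: hi].
Qed.

(** Reflection in the line of slope 1 through [p]. *)
Definition swap_at p z : manhattan R := (p.1 + (z.2 - p.2), p.2 + (z.1 - p.1)).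

Lemma swap_atK p : involutive (swap_at p).
Proof. by move=> [u v]; rewrite /swap_at /=; congr (_, _); lra. Qed.

Lemma swap_atp p : swap_at p p = p.
Proof. by rewrite /swap_at !subrr !addr0; case: p. Qed.

Lemma swap_at_d1 p x y : d1 (swap_at p x) (swap_at p y) = d1 x y.
Proof. by rewrite /d1 /= [LHS]addrC; congr (_ + _); congr Num.norm; lra. Qed.

Lemma normr1_mul_self (r : R) : `|r| = 1 -> r * r = 1.
Proof. by move=> r1; rewrite -expr2 -real_normK ?num_real // r1 expr1n. Qed.

Definition flip_at p (s t : R) z : manhattan R :=
  (p.1 + s * (z.1 - p.1), p.2 + t * (z.2 - p.2)).

Section Flip.
Variables (p : manhattan R) (s t : R).
Hypotheses (s1 : `|s| = 1) (t1 : `|t| = 1).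

Lemma flip_atK : involutive (flip_at p s t).
Proof.
move=> [u v]; rewrite /flip_at /=.
rewrite ![_ + (_ * _) - _]addrAC !subrr !add0r !mulrA !normr1_mul_self // !mul1r.
by congr (_, _); lra.
Qed.

Lemma flip_atp : flip_at p s t p = p.
Proof. by rewrite /flip_at !subrr !mulr0 !addr0; case: p. Qed.

Lemma flip_at_d1 x y : d1 (flip_at p s t x) (flip_at p s t y) = d1 x y.
Proof.
rewrite /d1 /=.
have E (u r v w : R) : `|r| = 1 ->
    `|u + r * (v - u) - (u + r * (w - u))| = `|v - w|.
  move=> r1; rewrite -[RHS]mul1r -r1 -normrM; congr `|_|; lra.
by rewrite !E.
Qed.

End Flip.

(** * Tight points are limits of enclosed points *)

Section TightNear.
Variables (A : set (manhattan R)) (p : manhattan R).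
Hypothesis Atight : tight_at A p.

(** If [y] is not itself near [p], it lies high above; the point of its column at height [p.2 + e]
    is then enclosed, thanks to a partner [z] of [y] at the lower right. *)
Lemma tight_strip x y (e : R) : 0 < e -> A x -> A y ->
  x.1 <= p.1 - e -> x.2 <= p.2 -> p.1 - e <= y.1 < p.1 -> p.2 - e <= y.2 ->
  exists2 q, enclosed A q & d1 p q <= e + e.
Proof.
move=> e0 Ax Ay x1 x2 /andP[y1 y1'] y2.
have [y2'|y2'] := leP y.2 (p.2 + e).
  exists y; first exact: enclosed_sub.
  by rewrite /d1 lerD // ler_norml; apply/andP; split; lra.
(* Half the gap between [y] and [p] ensures that [z] lies to the right of [y]. *)
pose e' := Num.min e ((p.1 - y.1) / 2).
have e'0 : 0 < e' by rewrite lt_min e0 /=; lra.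
have e'e : e' <= e by rewrite ge_min lexx.
have e'y : e' <= (p.1 - y.1) / 2 by rewrite ge_min lexx orbT.
have [z Az /tight_coord[z1 _ _ z2]] := Atight Ay e'0.
have {}z1 : p.1 - e' <= z.1 by apply: z1; lra.
have {}z2 : z.2 <= p.2 + e' by apply: z2; lra.
exists (y.1, p.2 + e).
  apply: enclosed_quadrants; [exists y|exists z|exists y|exists x] => //=;
    by split; lra.
by rewrite /d1 /= lerD // ler_norml; apply/andP; split; lra.
Qed.

(** When [A] lies in one quadrant at [p], the partner of a point away from both axes is itself close
    to [p]. *)
Lemma tight_side : A !=set0 -> (forall a, A a -> a.1 < p.1 /\ p.2 <= a.2) ->
  near_enclosed A p.
Proof.
move=> [x0 Ax0] Aside e e0.
suff [y Ay [y1 y2]] : exists2 y, A y & p.1 - e / 2 <= y.1 /\ y.2 <= p.2 + e / 2.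
  exists y; first exact: enclosed_sub.
  have [] := Aside y Ay; rewrite (splitr e) /d1 => ? ?.
  by rewrite lerD // ler_norml; apply/andP; split; lra.
have [[x [Ax x2]]|/forallNP noup] := pselect (exists x, A x /\ p.2 < x.2).
  have [x1 _] := Aside x Ax.
  pose d := Num.min (e / 2) (Num.min ((p.1 - x.1) / 2) ((x.2 - p.2) / 2)).
  have d0 : 0 < d by rewrite !lt_min; apply/and3P; split; lra.
  have de : d <= e / 2 by rewrite ge_min lexx.
  have dx1 : d <= (p.1 - x.1) / 2 by rewrite !ge_min lexx orbT.
  have dx2 : d <= (x.2 - p.2) / 2 by rewrite !ge_min lexx !orbT.
  have [y Ay /tight_coord[y1 _ _ y2]] := Atight Ax d0.
  have {}y1 : p.1 - d <= y.1 by apply: y1; lra.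
  have {}y2 : y.2 <= p.2 + d by apply: y2; lra.
  by exists y => //; split; lra.
(* Here [A] lies on the horizontal line through [p], so only first coordinates matter. *)
have [x1 _] := Aside x0 Ax0.
pose d := Num.min (e / 2) ((p.1 - x0.1) / 2).
have d0 : 0 < d by rewrite lt_min; apply/andP; split; lra.
have de : d <= e / 2 by rewrite ge_min lexx.
have dx1 : d <= (p.1 - x0.1) / 2 by rewrite !ge_min lexx orbT.
have [y Ay /tight_coord[y1 _ _ _]] := Atight Ax0 d0.
have {}y1 : p.1 - d <= y.1 by apply: y1; lra.
exists y => //; split; first lra.
have [//|y2] := leP y.2 (p.2 + e / 2).
by exfalso; apply: (noup y); split=> //; lra.
Qed.

End TightNear.

(** The upper right quadrant misses [A]. A point of [A] at the lower left has a partner in a thin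
    strip beside or below [p]; if there is no such point, [A] stays on one side of the diagonal. *)
Lemma tight_empty_quadrant A p : A !=set0 -> lipschitz_ivt A -> tight_at A p ->
  (forall a, A a -> p.1 <= a.1 -> a.2 < p.2) -> near_enclosed A p.
Proof.
move=> A0 Aivt Atight noA.
have swapT : tight_at (swap_at p @^-1` A) p.
  exact: (transport_tight (swap_atK p) (swap_atp p) (swap_at_d1 p)).
have swapN : near_enclosed (swap_at p @^-1` A) p -> near_enclosed A p.
  exact: (transport_near_enclosed (swap_atK p) (swap_atp p) (swap_at_d1 p)).
have [[x [Ax [x1 x2]]]|/forallNP noB] :=
    pselect (exists x, A x /\ x.1 < p.1 /\ x.2 < p.2).
  move=> e e0.
  pose d := Num.min (e / 2) (Num.min ((p.1 - x.1) / 2) ((p.2 - x.2) / 2)).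
  have d0 : 0 < d by rewrite !lt_min; apply/and3P; split; lra.
  have de : d <= e / 2 by rewrite ge_min lexx.
  have dx1 : d <= (p.1 - x.1) / 2 by rewrite !ge_min lexx orbT.
  have dx2 : d <= (p.2 - x.2) / 2 by rewrite !ge_min lexx !orbT.
  suff [q Aq pq] : exists2 q, enclosed A q & d1 p q <= d + d.
    by exists q => //; lra.
  have [y Ay /tight_coord[y1 _ y2 _]] := Atight x d Ax d0.
  have {}y1 : p.1 - d <= y.1 by apply: y1; lra.
  have {}y2 : p.2 - d <= y.2 by apply: y2; lra.
  have [yp|yp] := ltP y.1 p.1.
    by apply: (tight_strip Atight d0 Ax Ay); rewrite ?y1 //; lra.
  (* Now [y] lies in the strip just below [p]; the swap moves it to the left. *)
  have {}yp := noA y Ay yp.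
  have swapA a : A a -> (swap_at p @^-1` A) (swap_at p a).
    by rewrite /= swap_atK.
  have [||||q Bq pq] := tight_strip swapT d0 (swapA x Ax) (swapA y Ay);
    rewrite /=; [lra|lra|apply/andP; split; lra|lra|].
  exists (swap_at p q); last by rewrite -{1}(swap_atp p) swap_at_d1.
  move=> c; have [a Ba H] := Bq (swap_at p c); exists (swap_at p a) => //.
  by rewrite -(swap_at_d1 p) swap_atK H -(swap_at_d1 p) swap_atK -(swap_at_d1 p q).
(* The diagonal [g = 0] runs only through the two quadrants missing [A], so [g] keeps a constant
   sign on [A]. *)
pose g z := ((z.2 - p.2) - (z.1 - p.1)).
have g0 z : A z -> g z <> 0.
  move=> Az; rewrite /g => gz.
  have [z1|z1] := ltP z.1 p.1; first by apply: (noB z); split=> //; lra.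
  by have := noA z Az z1; lra.
have glip x y : `|g x - g y| <= d1 x y.
  rewrite /d1 /g addrC (distrC x.1).
  by apply: le_trans (ler_normD _ _); rewrite le_eqVlt; apply/orP; left;
    apply/eqP; congr `|_|; lra.
have [[x [Ax gx]]|/forallNP gpos] := pselect (exists x, A x /\ g x < 0); last first.
  apply: tight_side => // a Aa.
  have ga : 0 < g a.
    rewrite lt_neqAle; apply/andP; split; first by apply/eqP => /esym; exact: g0.
    by rewrite leNgt; apply/negP => ?; apply: (gpos a).
  have [a1|a1] := ltP a.1 p.1; last by have := noA a Aa a1; move: ga; rewrite /g; lra.
  split=> //; rewrite leNgt; apply/negP => a2; exact: (noB a).
apply: swapN; apply: tight_side => //.
  by case: A0 => a Aa; exists (swap_at p a); rewrite /= swap_atK.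
move=> b /= Ab; set a := swap_at p b in Ab.
suff [a1 a2] : p.1 <= a.1 /\ a.2 < p.2 by move: a1 a2; rewrite /a /=; split; lra.
have ga : g a < 0.
  rewrite ltNge; apply/negP => ga.
  have [z Az] := Aivt g glip x a Ax Ab (ltW gx) ga; exact: g0.
have [a1|a1] := ltP a.1 p.1; last by split=> //; exact: noA.
by exfalso; apply: (noB a); move: ga; rewrite /g; split=> //; split=> //; lra.
Qed.

(** If all four quadrants meet [A], then [p] is enclosed; otherwise a flip turns a missed quadrant
    into the upper right one. *)
Lemma tight_near_enclosed A p : A !=set0 -> lipschitz_ivt A -> tight_at A p ->
  near_enclosed A p.
Proof.
move=> A0 Aivt Atight.
have quad (s t : R) : `|s| = 1 -> `|t| = 1 -> near_enclosed A p \/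
    exists2 a, A a & 0 <= s * (a.1 - p.1) /\ 0 <= t * (a.2 - p.2).
  move=> s1 t1.
  have [|/forall2NP noA] := pselect (exists2 a, A a &
    0 <= s * (a.1 - p.1) /\ 0 <= t * (a.2 - p.2)); [by right|left].
  have fK := flip_atK p s1 t1; have fp := flip_atp p s t.
  have fd := flip_at_d1 p s1 t1.
  apply: (transport_near_enclosed fK fp fd); apply: tight_empty_quadrant.
  - by case: A0 => a Aa; exists (flip_at p s t a); rewrite /= fK.
  - exact: transport_ivt.
  - exact: transport_tight.
  move=> b Ab b1; rewrite ltNge; apply/negP => b2.
  have [//|] := noA (flip_at p s t b); apply => /=.
  by rewrite ![_ + (_ * _) - _]addrAC !subrr !add0r !mulrA !normr1_mul_self // !mul1r; split; lra.
have n1 : `|1 : R| = 1 by rewrite normr1.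
have nN1 : `|-1 : R| = 1 by rewrite normrN1.
have [//|[a1 A1 [? ?]]] := quad 1 1 n1 n1.
have [//|[a2 A2 [? ?]]] := quad 1 (-1) n1 nN1.
have [//|[a3 A3 [? ?]]] := quad (-1) 1 nN1 n1.
have [//|[a4 A4 [? ?]]] := quad (-1) (-1) nN1 nN1.
move=> e e0; exists p; last by rewrite d1xx ltW.
by apply: enclosed_quadrants; [exists a1|exists a2|exists a3|exists a4] => //;
  split; lra.
Qed.

(* In the coordinates x + y and x - y the closed l1-balls are axis-parallel
   boxes, so pairwise intersecting balls have a common point. *)
Lemma d1_hyperconvex (I : Type) (c : I -> manhattan R) (r : I -> R) :
  (forall i j, d1 (c i) (c j) <= r i + r j) ->
  exists p, forall i, d1 p (c i) <= r i.
Proof.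
move=> cr; have [[i0 _]|/nonemptyPn I0] := pselect ([set: I] !=set0); last first.
  by exists (0, 0) => i; have : [set: I] i by []; rewrite I0.
have common (h : I -> R) : (forall i j, h i - h j <= d1 (c i) (c j)) ->
    exists u, forall i, h i - r i <= u <= h i + r i.
  move=> hd; pose S := [set h i - r i | i in [set: I]].
  have Sub i : ubound S (h i + r i).
    by move=> _ [j _ <-]; have := hd j i; have := cr j i; lra.
  have S0 : S !=set0 by exists (h i0 - r i0), i0.
  exists (sup S) => i; rewrite ge_sup // andbT.
  by apply: ub_le_sup; [exists (h i0 + r i0)|exists i].
have [i j|u uP] := common (fun i => (c i).1 + (c i).2).
  rewrite /d1; have := ler_norm ((c i).1 - (c j).1).
  by have := ler_norm ((c i).2 - (c j).2); lra.
have [i j|v vP] := common (fun i => (c i).1 - (c i).2).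
  rewrite /d1 (distrC (c i).2); have := ler_norm ((c i).1 - (c j).1).
  by have := ler_norm ((c j).2 - (c i).2); lra.
exists ((u + v) / 2, (u - v) / 2) => i; rewrite /d1 /=.
have /andP[? ?] := uP i; have /andP[? ?] := vP i.
by case: (ger0P ((u + v) / 2 - _)); case: (ger0P ((u - v) / 2 - _)) => *; lra.
Qed.

(** * Distance functions in the tight span, and the isometry *)

Definition dist_to A p (x : set_type A) : R := d1 p (\val x).

Lemma dist_to_dominates A p : dominates_dist (dist_to (A := A) p).
Proof.
split=> [x|x y]; first exact: d1_ge0.
by rewrite /dist_to (d1_sym p); exact: d1_triangle.
Qed.

Lemma near_enclosed_minimal A p :
  near_enclosed A p -> minimal_dominating (dist_to (A := A) p).
Proof.
move=> nA; apply: tight_minimal_dominating; first exact: dist_to_dominates.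
move=> x e e0; have [|q Aq pq] := nA (e / 2); first by rewrite divr_gt0.
(* Distances from [x] to [a] add up exactly through [q]; replacing [q] by [p] costs at most [e / 2]
   twice. *)
have [a Aa H] := Aq (\val x); exists (exist _ a (mem_set Aa)).
rewrite /dist_to; have -> : mdist x (exist _ a (mem_set Aa)) = d1 (\val x) a by [].
have := d1_triangle q p (\val x); have := d1_triangle q p a.
by rewrite /= H (d1_sym (\val x)); lra.
Qed.

End Plane.

Theorem theorem2 (R : realType) (A : set (manhattan R)) :
  path_connected R A ->
  isometric (set_type (closure (double_hatching A))) (tight_span (set_type A)).
Proof.
move=> Apc; have Aivt := path_connected_ivt Apc; have [A0 _] := Apc.
have nearP (p : set_type (closure (double_hatching A))) :
  near_enclosed A (\val p) by apply: closure_near_enclosed; exact: set_valP.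
pose phi p := TightSpan (near_enclosed_minimal (nearP p)).
have phi_iso p q : mdist (phi p) (phi q) = mdist p q.
  rewrite -[LHS]/(dinfty (phi p) (phi q)) -[RHS]/(d1 (\val p) (\val q)).
  apply/eqP; rewrite eq_le; apply/andP; split.
    apply: dinfty_le => [|x]; first exact: d1_ge0.
    rewrite /= /dist_to ler_norml; have := d1_triangle (\val q) (\val p) (\val x).
    have := d1_triangle (\val p) (\val q) (\val x); rewrite (d1_sym (\val q) (\val p)).
    by move=> *; apply/andP; split; lra.
  apply/ler_addgt0Pr => e e0.
  have [|q' Aq' qq'] := nearP q (e / 2); first by rewrite divr_gt0.
  (* At [a], beyond [q'] as seen from [p], the two distance functions differ by at least
     [d1 p q - e]. *)
  have [a Aa H] := Aq' (\val p).
  have L : `|d1 (\val p) a - d1 (\val q) a| <= dinfty (phi p) (phi q).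
    exact: le_dinfty (phi p) (phi q) (exist _ a (mem_set Aa)).
  have := le_trans (ler_norm _) L.
  have := d1_triangle q' (\val p) (\val q); have := d1_triangle q' (\val q) a.
  by rewrite H (d1_sym q' (\val q)); lra.
exists phi => //; rewrite -setTT_bijective; split=> //.
  by move=> p q _ _ pq; apply: mdist_positivity; rewrite -phi_iso pq mdistxx.
move=> f _; have [[f0 fd] fmin] := ts_funP f.
(* The values of [f] are taken as radii of balls around the points of [A]; a common point [p] gives
   a distance function below [f], hence equal to [f]. *)
have [p pf] := d1_hyperconvex (c := fun x : set_type A => \val x) fd.
have pE := fmin _ (dist_to_dominates A p) pf.
have Atight : tight_at A p.
  move=> x e Ax e0; pose x' : set_type A := exist _ x (mem_set Ax).
  have [y] := minimal_dominating_tight (ts_funP f) x' e0.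
  by rewrite -pE /dist_to => H; exists (\val y) => //; exact: set_valP.
have Cp := near_enclosed_closure Aivt (tight_near_enclosed A0 Aivt Atight).
exists (exist _ p (mem_set Cp)) => //.
by apply: tight_span_eq => x; rewrite -pE.
Qed.
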